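(* Let $K \subset \mathbb{C}$ be a bounded convex domain. For every $\varepsilon > 0$ there exists a constant $c_{K,\varepsilon} > 0$ (depending only on $K$ and $\varepsilon$) such that for every integer $n \geq 2$ and every polynomial $p_n : \mathbb{C} \to \mathbb{C}$ of degree $n$ the following holds: if $$ \# \left\{ z \in \mathbb{C} \setminus K : p_n(z) = 0 \right\} \leq c_{K,\varepsilon} \frac{n}{\log n}, $$ then $$ \# \left\{ z \in K_{\varepsilon} : p_n'(z) = 0 \right\} \geq \# \left\{ z \in K : p_n(z) = 0 \right\} - 1, $$ where all roots are counted with multiplicity.
   Context: $K_{\varepsilon}$ denotes the $\varepsilon$-neighborhood of $K$ in $\mathbb{C}$, i.e. the set of points at distance less than $\varepsilon$ from $K$. The notation $\#\{z \in S : f(z) = 0\}$ denotes the number of roots of the polynomial $f$ in $S$, counted with multiplicity. A domain is a nonempty connected open set. *)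

(* Defs.v *)
(* The complex numbers are R[i] for R : realType. *)
From HB Require Import structures.
From mathcomp Require Import all_boot all_order all_algebra.
From mathcomp Require Import all_classical all_reals all_analysis.
From mathcomp Require Import complex.

Set Implicit Arguments.
Unset Strict Implicit.
Unset Printing Implicit Defensive.

Import Order.TTheory GRing.Theory Num.Theory.
Import numFieldNormedType.Exports.

Local Open Scope classical_set_scope.
Local Open Scope ring_scope.
Local Open Scope complex_scope.

(* The topology of the complex plane is carried by R[i]^o. *)
Definition complex_domain (R : realType) (K : set R[i]^o) : Prop :=
  [/\ K !=set0, open K & connected K].

(* Rcomplex R is R[i] as a vector space over R: the weights of the convex
   combinations are reals in [0, 1]. *)
Definition complex_convex (R : realType) (K : set R[i]) : Prop :=
  convex_set (K : set (convex_lmodType (Rcomplex R))).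

(* The norm of R[i] takes its (real) values in R[i], hence eps%:C. *)
Definition eps_neighborhood (R : realType) (K : set R[i]) (eps : R) :
    set R[i] :=
  [set z | exists2 w, K w & `|z - w| < eps%:C].

(* The sum ranges over the z in S with mup z p != 0, i.e. the roots of p in S
   (finitely many when p != 0). *)
Definition nb_roots (F : fieldType) (p : {poly F}) (S : set F) : nat :=
  \big[addn/0%N]_(z \in S) mup (z : F) p.

(* Main.v *)
Require Import Defs.
From HB Require Import structures.
From mathcomp Require Import all_boot all_order all_algebra.
From mathcomp Require Import all_classical all_reals all_analysis.
From mathcomp Require Import complex ring lra zify.
Import Order.TTheory GRing.Theory Num.Theory.
Import numFieldNormedType.Exports.
Import Normc.
Local Open Scope classical_set_scope.
Local Open Scope ring_scope.
Local Open Scope complex_scope.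

(** Write p = c q r, where q and r are monic, the m roots of q lie in K and
    the k roots of r lie outside K, and let d be the distance to K. The polynomials
    F_s = q' r + s q r', for s in [0, 1], join q' r to p' / c. If no F_s
    vanishes on a level curve d = t with 0 < t < eps, then the number of roots
    with d <= t is the same at both ends. At s = 0 it is at least m - 1,
    because by Gauss-Lucas the m - 1 roots of q' are in the closure of K;
    hence p' has at least m - 1 roots in the eps-neighborhood of K.

    Off the roots of p, F_s = q r (q'/q + s r'/r), so it is enough that
    |q'/q| > |r'/r| on the curve. For the left side, a point z with d(z) = t > 0 is
    separated from K by a line (separation), so that the terms 1/(z - a) of q'/q
    all point into one half-plane, whence |q'/q| >= C m, with C > 0 depending
    only on K and eps as long as t >= eps/2 (logder_lower). For the right
    side, d is 1-Lipschitz, so |r'/r| is at most the sum over the roots w of r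
    of 1/|t - d(w)|. A pigeonhole argument over n equally spaced levels gives
    a t in [eps/2, eps) where this sum is at most of order k H_n / eps, with H_n the
    n-th harmonic number (exists_good_level). As H_n is of order log n,
    the hypothesis k <= c n / log n makes it smaller than C m when c is small.
    This last step is where the logarithm comes from.

    The number of roots with d <= t is constant in s by the following replacement
    for Rouche's theorem (pencil_count). The set of pairs (s, roots of F_s) is
    compact, so the s for which F_s has at least j roots in a given closed
    set form a closed set. Applied to d <= t and to d >= t, which share
    no root of F_s, with counts j and deg F_s - j + 1, this writes [0, 1] as a
    union of two disjoint closed sets, and [0, 1] is connected. *)

Set Implicit Arguments.
Unset Strict Implicit.
Unset Printing Implicit Defensive.

(** * Complex functions by coordinates *)

Lemma normc_geRe (R : realType) (z : R[i]) : `|complex.Re z| <= normc z.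
Proof. by case: z => a b /=; rewrite -sqrtr_sqr ler_wsqrtr // lerDl sqr_ge0. Qed.

Lemma normc_geIm (R : realType) (z : R[i]) : `|complex.Im z| <= normc z.
Proof. by case: z => a b /=; rewrite -sqrtr_sqr ler_wsqrtr // lerDr sqr_ge0. Qed.

(** Continuity is tested on the real coordinates, so that compactness of boxes
    of real row vectors can be used for tuples of complex numbers. *)
Definition ccontinuous (R : realType) (T : topologicalType) (f : T -> R[i]) :=
  continuous (fun v => complex.Re (f v)) /\ continuous (fun v => complex.Im (f v)).

Section Ccont.
Variables (R : realType) (T : topologicalType).
Implicit Types f g : T -> R[i].

Lemma ccontinuousD f g : ccontinuous f -> ccontinuous g ->
  ccontinuous (fun v => f v + g v).
Proof.
move=> [f1 f2] [g1 g2]; split.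
  rewrite (_ : (fun v => _) = (fun v => complex.Re (f v) + complex.Re (g v))); last first.
    by apply/funext => v; case: (f v) (g v) => a b [].
  by move=> v; apply: cvgD; [exact: f1|exact: g1].
rewrite (_ : (fun v => _) = (fun v => complex.Im (f v) + complex.Im (g v))); last first.
  by apply/funext => v; case: (f v) (g v) => a b [].
by move=> v; apply: cvgD; [exact: f2|exact: g2].
Qed.

Lemma ccontinuousM f g : ccontinuous f -> ccontinuous g ->
  ccontinuous (fun v => f v * g v).
Proof.
move=> [f1 f2] [g1 g2]; split.
  rewrite (_ : (fun v => _) = (fun v => complex.Re (f v) * complex.Re (g v)
      - complex.Im (f v) * complex.Im (g v))); last first.
    by apply/funext => v; case: (f v) (g v) => a b [].
  by move=> v; apply: cvgB; apply: cvgM; [exact: f1|exact: g1|exact: f2|exact: g2].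
rewrite (_ : (fun v => _) = (fun v => complex.Re (f v) * complex.Im (g v)
      + complex.Im (f v) * complex.Re (g v))); last first.
  by apply/funext => v; case: (f v) (g v) => a b [].
by move=> v; apply: cvgD; apply: cvgM; [exact: f1|exact: g2|exact: f2|exact: g1].
Qed.

Lemma ccontinuous_cst (z : R[i]) : ccontinuous (fun _ : T => z).
Proof. by split=> v; exact: cvg_cst. Qed.

Lemma ccontinuous_prod (I : Type) (r : seq I) (F : I -> T -> R[i]) :
  (forall i, ccontinuous (F i)) -> ccontinuous (fun v => \prod_(i <- r) F i v).
Proof.
move=> cF; elim: r => [|i r IH].
  rewrite (_ : (fun v => _) = fun=> 1); first exact: ccontinuous_cst.
  by apply/funext => v; rewrite big_nil.
rewrite (_ : (fun v => _) = fun v => F i v * \prod_(i <- r) F i v); last first.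
  by apply/funext => v; rewrite big_cons.
exact: ccontinuousM.
Qed.

Lemma ccontinuous_closed_eq f g : ccontinuous f -> ccontinuous g ->
  closed [set v | f v = g v].
Proof.
move=> cf cg.
have [c1 c2] : ccontinuous (fun v => f v + (-1) * g v).
  by apply: ccontinuousD => //; apply: ccontinuousM => //; exact: ccontinuous_cst.
rewrite (_ : mkset _ = (fun v => complex.Re (f v + (-1) * g v)) @^-1` [set x | x = 0]
   `&` (fun v => complex.Im (f v + (-1) * g v)) @^-1` [set x | x = 0]).
  apply: closedI.
    by move/continuous_closedP : c1 => /(_ [set x | x = 0]); apply; exact: closed_eq.
  by move/continuous_closedP : c2 => /(_ [set x | x = 0]); apply; exact: closed_eq.
apply/seteqP; split => v /=.
  by move=> ->; rewrite mulN1r subrr.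
rewrite mulN1r => -[a b]; apply/eqP; rewrite -subr_eq0; apply/eqP.
by move: a b; case: (f v - g v) => a b /= -> ->.
Qed.

End Ccont.

Definition cclosed (R : realType) (P : set R[i]) :=
  closed [set v : R * R | P (v.1 +i* v.2)].

Lemma cclosed_comp (R : realType) (T : topologicalType) (P : set R[i]) (f : T -> R[i]) :
  cclosed P -> ccontinuous f -> closed [set v | P (f v)].
Proof.
move=> cP [f1 f2].
have cg : continuous (fun v => (complex.Re (f v), complex.Im (f v))).
  by move=> v; apply: (cvg_pair (f1 v) (f2 v)).
move/continuous_closedP : cg => /(_ _ cP).
by congr closed; apply/seteqP; split => v /=; case: (f v).
Qed.

(** * Root tuples of a pencil of polynomials *)

Section Pencil.
Variables (R : realType) (d : nat) (A B : {poly R[i]}) (M : R).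

Definition pencil (s : R) : {poly R[i]} := A + s%:C *: B.
(** The leading coefficient of the pencil at s when the degree there is d; unlike
    lead_coef it is visibly continuous in s. *)
Definition plead (s : R) : R[i] := A`_d + s%:C * B`_d.

Definition seqC (v : 'rV[R]_d * 'rV[R]_d) (i : 'I_d) : R[i] :=
  v.1 ord0 i +i* v.2 ord0 i.

(** Pairs of a parameter s and an enumeration, inside the box of radius M, of the
    roots of the pencil at s, whose first j entries lie in P. Equality with the
    product over the roots is imposed on values at all z, each of which is a
    closed condition. *)
Definition root_tuples (P : set R[i]) (j : nat) : set (R * ('rV[R]_d * 'rV[R]_d)) :=
  (`[0, 1]%classic `*` ([set x : 'rV[R]_d | forall i, `[- M, M]%classic (x ord0 i)] `*`
                [set y : 'rV[R]_d | forall i, `[- M, M]%classic (y ord0 i)]))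
  `&` ([set w | forall z : R[i],
          (pencil w.1).[z] = plead w.1 * \prod_i (z - seqC w.2 i)] `&`
       [set w | forall i : 'I_d, (i < j)%N -> P (seqC w.2 i)]).

Lemma seqC_continuous (i : 'I_d) :
  ccontinuous (fun w : R * ('rV[R]_d * 'rV[R]_d) => seqC w.2 i).
Proof.
have c2 : continuous (fun w : R * ('rV[R]_d * 'rV[R]_d) => w.2).
  by move=> w; exact: cvg_snd.
have c21 : continuous (fun w : R * ('rV[R]_d * 'rV[R]_d) => w.2.1).
  by move=> w; apply: (@continuous_comp _ _ _ _ fst w (c2 w)); exact: cvg_fst.
have c22 : continuous (fun w : R * ('rV[R]_d * 'rV[R]_d) => w.2.2).
  by move=> w; apply: (@continuous_comp _ _ _ _ snd w (c2 w)); exact: cvg_snd.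
split => w.
  apply: (@continuous_comp _ _ _ _ (fun v : 'rV[R]_d => v ord0 i) w (c21 w)).
  exact: coord_continuous.
apply: (@continuous_comp _ _ _ _ (fun v : 'rV[R]_d => v ord0 i) w (c22 w)).
exact: coord_continuous.
Qed.

Lemma root_tuples_compact P j : cclosed P -> compact (root_tuples P j).
Proof.
move=> cP; apply: compact_closedI.
  apply: compact_setX; first exact: segment_compact.
  by apply: compact_setX;
    apply: (@rV_compact R d (fun=> `[- M, M]%classic)) => _; exact: segment_compact.
apply: closedI.
  rewrite (_ : mkset _ = \bigcap_(z in setT) [set w : R * ('rV[R]_d * 'rV[R]_d) |
     (pencil w.1).[z] = plead w.1 * \prod_i (z - seqC w.2 i)]); last first.
    by apply/seteqP; split => w /= h z => [_|]; apply: h.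
  apply: closed_bigI => z _.
  have cs : ccontinuous (fun w : R * ('rV[R]_d * 'rV[R]_d) => (w.1)%:C).
    by split => w /=; [exact: cvg_fst|exact: cvg_cst].
  apply: ccontinuous_closed_eq.
    rewrite (_ : (fun w => _) = fun w : R * ('rV[R]_d * 'rV[R]_d) => A.[z] + (w.1)%:C * B.[z]).
      apply: ccontinuousD; first exact: ccontinuous_cst.
      by apply: ccontinuousM => //; exact: ccontinuous_cst.
    by apply/funext => w; rewrite /pencil hornerD hornerZ.
  apply: ccontinuousM.
    apply: ccontinuousD; first exact: ccontinuous_cst.
    by apply: ccontinuousM => //; exact: ccontinuous_cst.
  apply: ccontinuous_prod => i.
  rewrite (_ : (fun v => _) = fun v => z + (-1) * seqC v.2 i); last first.
    by apply/funext => v; rewrite mulN1r.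
  apply: ccontinuousD; first exact: ccontinuous_cst.
  by apply: ccontinuousM; [exact: ccontinuous_cst|exact: seqC_continuous].
rewrite (_ : mkset _ = \bigcap_(i in [set i : 'I_d | (i < j)%N])
    [set w : R * ('rV[R]_d * 'rV[R]_d) | P (seqC w.2 i)]); last first.
  by apply/seteqP; split => w /= h i; apply: h.
by apply: closed_bigI => i _; apply: cclosed_comp => //; exact: seqC_continuous.
Qed.

End Pencil.

(** * Counting the roots of a pencil in a closed set *)

Lemma polyfun_inj (F : numDomainType) (p q : {poly F}) :
  (forall z, p.[z] = q.[z]) -> p = q.
Proof.
move=> pq; apply/eqP; rewrite -subr_eq0; apply/eqP.
apply: (@roots_geq_poly_eq0 _ _ [seq i%:R | i <- iota 0 (size (p - q))]).
- by apply/allP => z _; rewrite /= rootE hornerD hornerN pq subrr.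
- by rewrite map_inj_uniq ?iota_uniq // => i j /eqP; rewrite eqr_nat => /eqP.
- by rewrite size_map size_iota.
Qed.

Section PencilCount.
Variables (R : realType) (d : nat) (A B : {poly R[i]}) (M : R).
Hypothesis size_pencil : forall s : R, 0 <= s <= 1 -> size (pencil A B s) = d.+1.
Hypothesis bounded_roots : forall (s : R) (z : R[i]), 0 <= s <= 1 ->
  root (pencil A B s) z -> normc z <= M.

Lemma lead_pencil s : 0 <= s <= 1 -> lead_coef (pencil A B s) = plead d A B s.
Proof.
by move=> s01; rewrite lead_coefE size_pencil //= /pencil coefD coefZ.
Qed.

(** A list of roots with at least j entries in P is turned into a root tuple by
    listing first its entries in P. *)
Lemma root_tuplesP (P : pred R[i]) (j : nat) (s : R) (rs : seq R[i]) :
  0 <= s <= 1 -> pencil A B s = lead_coef (pencil A B s) *: \prod_(z <- rs) ('X - z%:P) ->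
  (j <= d)%N ->
  (exists v, @root_tuples R d A B M [set z | P z] j (s, v)) <-> (j <= count P rs)%N.
Proof.
move=> s01 rsE jd; set l := lead_coef _ in rsE.
have l0 : l != 0 by rewrite lead_coef_eq0 -size_poly_eq0 size_pencil.
have szrs : size rs = d.
  by have := size_pencil s01; rewrite rsE size_scale // size_prod_XsubC => -[].
split.
  move=> [v [_ [/= hz hP]]].
  set vs := [seq seqC v i | i <- enum 'I_d].
  have vsE : perm_eq vs rs.
    apply: prod_XsubC_eq; apply: polyfun_inj => z.
    apply: (mulfI l0); rewrite -hornerZ -[RHS]hornerZ -rsE hz -lead_pencil // -/l.
    rewrite hornerZ horner_prod big_map big_enum /=; congr (_ * _).
    by apply: eq_bigr => i _; rewrite !hornerE.
  rewrite -(permP vsE P) /vs count_map.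
  rewrite -[X in (X <= _)%N](_ : count (fun i : 'I_d => (i < j)%N) (enum 'I_d) = j).
    by apply: sub_count => i /= /hP.
  rewrite -[LHS](count_map val (fun i => (i < j)%N)) val_enum_ord.
  rewrite -(subnKC jd) iotaD count_cat add0n.
  have -> : count (fun i => (i < j)%N) (iota 0 j) = j.
    apply/eqP; rewrite -[X in _ == X](size_iota 0 j) -all_count.
    by apply/allP => i; rewrite mem_iota.
  have -> : count (fun i => (i < j)%N) (iota j (d - j)) = 0%N; last by rewrite addn0.
  apply/eqP; rewrite -leqn0 leqNgt -has_count; apply/hasP; case=> i.
  by rewrite mem_iota => /andP[ji _]; rewrite ltnNge ji.
move=> jP.
pose rs' := [seq z <- rs | P z] ++ [seq z <- rs | predC P z].
have prs : perm_eq rs' rs by apply/permPl; exact: perm_filterC.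
have szrs' : size rs' = d by rewrite (perm_size prs).
pose v : 'rV[R]_d * 'rV[R]_d :=
  (\row_i complex.Re (rs'`_i), \row_i complex.Im (rs'`_i)).
have vE i : seqC v i = rs'`_i.
  by rewrite /seqC !mxE; case: (rs'`_i).
have bnd i : normc (rs'`_i : R[i]) <= M \/ (d <= i)%N.
  case: (leqP d i) => [|id]; [by right|left].
  apply: (bounded_roots s01); rewrite rsE rootZ // root_prod_XsubC.
  by rewrite -(perm_mem prs) mem_nth ?szrs'.
exists v; split => /=.
  split; first by rewrite /= in_itv.
  split => i /=; rewrite mxE in_itv /= -ler_norml.
    case: (bnd i) => [|]; last by rewrite leqNgt ltn_ord.
    by apply: le_trans; exact: normc_geRe.
  case: (bnd i) => [|]; last by rewrite leqNgt ltn_ord.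
  by apply: le_trans; exact: normc_geIm.
split => /= [z|i ij].
  rewrite -lead_pencil // -/l rsE hornerZ horner_prod -(perm_big _ prs) /=.
  rewrite (big_nth 0) big_mkord szrs'; congr (_ * _).
  by apply: eq_bigr => i _; rewrite vE !hornerE.
rewrite vE /rs' nth_cat size_filter (leq_trans ij jP).
have : (rs'`_i) \in [seq z <- rs | P z].
  by rewrite /rs' nth_cat size_filter (leq_trans ij jP) mem_nth // size_filter (leq_trans ij jP).
by rewrite /rs' nth_cat size_filter (leq_trans ij jP) mem_filter => /andP[].
Qed.

(** The parameters s at which at least j roots lie in a closed set form the
    projection of a compact set: the number of roots, counted with multiplicity, in a
    closed set is upper semicontinuous. *)
Lemma closed_many_roots (P : pred R[i]) (j : nat) : cclosed [set z | P z] ->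
  closed (fst @` @root_tuples R d A B M [set z | P z] j : set R).
Proof.
move=> cP; apply: compact_closed; first exact: Rhausdorff.
apply: continuous_compact; last exact: root_tuples_compact.
by apply: continuous_subspaceT => w; exact: cvg_fst.
Qed.

(** As no root crosses the level phi = 0, the roots with phi <= 0 and those with
    phi >= 0 are d in total. Having at least j roots of the first kind is therefore the
    complement of having more than d - j of the second kind; both conditions
    are closed in s, and [0, 1] is connected. *)
Lemma pencil_count (phi : R[i] -> R) (rs0 rs1 : seq R[i]) :
  continuous (fun v : R * R => phi (v.1 +i* v.2)) ->
  (forall (s : R) z, 0 <= s <= 1 -> root (pencil A B s) z -> phi z != 0) ->
  pencil A B 0 = lead_coef (pencil A B 0) *: \prod_(z <- rs0) ('X - z%:P) ->
  pencil A B 1 = lead_coef (pencil A B 1) *: \prod_(z <- rs1) ('X - z%:P) ->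
  (count (fun z => (phi z <= 0)%R) rs0 <= count (fun z => (phi z <= 0)%R) rs1)%N.
Proof.
move=> cphi phi0 rs0E rs1E.
pose In := fun z => phi z <= 0; pose Out := fun z => phi z >= 0.
have cIn : cclosed [set z | In z].
  by move/continuous_closedP : cphi => /(_ [set x | x <= 0]); apply; exact: closed_le.
have cOut : cclosed [set z | Out z].
  by move/continuous_closedP : cphi => /(_ [set x | x >= 0]); apply; exact: closed_ge.
set j := count _ rs0.
have size_rs s rs : 0 <= s <= 1 ->
    pencil A B s = lead_coef (pencil A B s) *: \prod_(z <- rs) ('X - z%:P) ->
    size rs = d.
  move=> s01 rsE; have := size_pencil s01; rewrite rsE size_scale.
    by rewrite size_prod_XsubC => -[].
  by rewrite lead_coef_eq0 -size_poly_eq0 size_pencil.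
have zero01 : 0 <= (0 : R) <= 1 by rewrite lexx ler01.
have one01 : 0 <= (1 : R) <= 1 by rewrite lexx ler01.
have jd : (j <= d)%N by rewrite -(size_rs _ _ zero01 rs0E) count_size.
have d_split s rs : 0 <= s <= 1 ->
    pencil A B s = lead_coef (pencil A B s) *: \prod_(z <- rs) ('X - z%:P) ->
    (count In rs + count Out rs = d)%N.
  move=> s01 rsE; rewrite -(size_rs _ _ s01 rsE) -(count_predC In rs).
  congr addn; apply: eq_in_count => z zrs /=.
  rewrite /Out /In -ltNge le_eqVlt eq_sym (negPf (phi0 s z s01 _)) //.
  rewrite rsE rootZ ?root_prod_XsubC //.
  by rewrite lead_coef_eq0 -size_poly_eq0 size_pencil.
case: (posnP j) => [->//|j_gt0].
pose Cin := fst @` @root_tuples R d A B M [set z | In z] j.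
pose Cout := fst @` @root_tuples R d A B M [set z | Out z] (d - j).+1.
have dj : ((d - j).+1 <= d)%N by rewrite ltn_subrL j_gt0 (leq_trans j_gt0).
have inP s rs : 0 <= s <= 1 ->
    pencil A B s = lead_coef (pencil A B s) *: \prod_(z <- rs) ('X - z%:P) ->
    Cin s <-> (j <= count In rs)%N.
  move=> s01 rsE; rewrite -(root_tuplesP In s01 rsE jd); split.
    by move=> [[s' v] ? /= <-]; exists v.
  by move=> [v ?]; exists (s, v).
have outP s rs : 0 <= s <= 1 ->
    pencil A B s = lead_coef (pencil A B s) *: \prod_(z <- rs) ('X - z%:P) ->
    Cout s <-> ~ (j <= count In rs)%N.
  move=> s01 rsE; have dE := d_split _ _ s01 rsE.
  have -> : (~ (j <= count In rs)%N) <-> ((d - j).+1 <= count Out rs)%N.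
    split => [/negP|]; rewrite -?ltnNge => h; last apply/negP; lia.
  rewrite -(root_tuplesP Out s01 rsE dj); split.
    by move=> [[s' v] ? /= <-]; exists v.
  by move=> [v ?]; exists (s, v).
have seg : `[0, 1]%classic `&` Cin = (`[0, 1]%classic : set R).
  apply: (@segment_connected R 0 1).
  - exists 0; split; first by rewrite /= in_itv.
    by apply/(inP _ _ zero01 rs0E).
  - exists (~` Cout); first by apply: closed_openC; exact: closed_many_roots.
    apply/seteqP; split => s [].
      rewrite /= in_itv /= => s01 Cs; split => //.
      have [rs rsE] := closed_field_poly_normal (pencil A B s).
      by move/(inP _ _ s01 rsE) : Cs => h /(outP _ _ s01 rsE).
    rewrite /= in_itv /= => s01 Cs; split => //.
    have [rs rsE] := closed_field_poly_normal (pencil A B s).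
    apply/(inP _ _ s01 rsE); apply: contrapT => h; apply: Cs.
    exact/(outP _ _ s01 rsE).
  - exists Cin; first exact: closed_many_roots.
    by [].
have : (`[0, 1]%classic : set R) 1 by rewrite /= in_itv.
by rewrite -seg => -[_ /(inP _ _ one01 rs1E)].
Qed.

End PencilCount.

(** * Harmonic sums and a level far from finitely many points *)

Definition harm (R : fieldType) (n : nat) : R := \sum_(i < n) i.+1%:R^-1.

Section Harmonic.
Variable R : realType.

Lemma harm_ge0 n : 0 <= harm R n.
Proof. by apply: sumr_ge0 => i _; rewrite invr_ge0. Qed.

Lemma harm_le m n : (m <= n)%N -> harm R m <= harm R n.
Proof.
move=> /subnKC <-; elim: (n - m)%N => [|k IH]; first by rewrite addn0.
by rewrite addnS /harm big_ord_recr /=; apply: (le_trans IH); rewrite lerDl invr_ge0.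
Qed.

Lemma harm_le_ln n : (0 < n)%N -> harm R n <= 1 + ln n%:R.
Proof.
case: n => // n _; elim: n => [|n IH].
  by rewrite /harm big_ord1 ln1 addr0 invr1.
rewrite /harm big_ord_recr /=; apply: (le_trans (lerD IH (lexx _))).
rewrite -addrA lerD2l.
have n1 : 0 < n.+1%:R :> R by rewrite ltr0n.
have n2 : 0 < n.+2%:R :> R by rewrite ltr0n.
have : ln (1 + - n.+2%:R^-1) <= - n.+2%:R^-1 :> R.
  by apply: le_ln1Dx; rewrite ltrN2 invf_lt1 // ltr1n.
have -> : 1 + - n.+2%:R^-1 = n.+1%:R / n.+2%:R :> R.
  have -> : n.+2%:R = n.+1%:R + 1 :> R by rewrite -natr1.
  by field; rewrite -natr1 (addrC n%:R) in n1; apply: lt0r_neq0; lra.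
by rewrite ln_div ?posrE // => h; rewrite -lerBrDl -opprB lerNr.
Qed.

(** The term i = i0 is 0, as 0^-1 = 0; each side of i0 contributes at most a harmonic
    sum. *)
Lemma sum_inv_dist (N : nat) (i0 : 'I_N) :
  \sum_(i < N) `|i%:R - i0%:R|^-1 <= 2 * harm R N.
Proof.
rewrite -(big_mkord xpredT (fun i => `|i%:R - i0%:R|^-1 : R)).
rewrite (big_cat_nat (n := i0)) ?(ltnW (ltn_ord i0)) //=.
rewrite [X in _ + X]big_ltn ?ltn_ord // subrr normr0 invr0 add0r mulrDl mul1r.
apply: lerD.
  rewrite big_nat_rev /= add0n big_mkord.
  apply: le_trans (harm_le (ltnW (ltn_ord i0))); apply: ler_sum => i _.
  rewrite distrC -natrB ?leq_subr // subKn // normr_nat //.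
rewrite -[i0.+1]add0n big_addn big_mkord.
apply: le_trans (harm_le (leq_subr i0.+1 N)); apply: ler_sum => i _.
by rewrite addnS -addSn natrD addrK normr_nat.
Qed.

(** For x in s let near x be the grid index closest to x. Then
    |i - near x| <= 2 |i - x| for all i, so that on the set G of the at least N/2
    indices that are nearest to no x, the sum over i of 1/|i - x| is at
    most four times the harmonic sum. An index in G where the sum over s does not exceed
    its average over G is a good one. *)
Lemma sparse_grid_point (N : nat) (s : seq R) : (0 < N)%N -> (2 * size s <= N)%N ->
  exists2 i : 'I_N, (forall x, x \in s -> i%:R != x) &
    \sum_(x <- s) `|i%:R - x|^-1 <= 8 * (size s)%:R * harm R N / N%:R.
Proof.
case: N => // n _ sN; set N := n.+1 in sN *.
have nearest (x : R) : {i0 : 'I_N | forall i : 'I_N, `|i%:R - i0%:R| <= 2 * `|i%:R - x|}.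
  have [i0 _ hi0] := arg_minP (fun i : 'I_N => `|i%:R - x|) (erefl (xpredT (ord0 : 'I_N))).
  exists i0 => i.
  (* triangle inequality through x, then minimality of i0 *)
  have := ler_distD x i%:R i0%:R; have := hi0 i isT; rewrite (distrC x).
  lra.
pose near x := sval (nearest x).
pose G := finset (fun i : 'I_N => i \notin map near s).
have cG : (N <= 2 * #|G|)%N.
  have : (#|~: G| <= size s)%N.
    rewrite -(size_map near s); apply: leq_trans (card_size _).
    by apply: subset_leq_card; apply/fintype.subsetP => i; rewrite !inE negbK.
  have := cardsC G; rewrite card_ord; lia.
have G0 : (0 < #|G|)%N by lia.
have GP i x : i \in G -> x \in s -> 0 < `|i%:R - (near x)%:R| :> R.
  rewrite inE => iG xs; rewrite normr_gt0 subr_eq0 eqr_nat.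
  by apply: contra iG => /eqP/val_inj ->; exact: map_f.
pose b := 8 * (size s)%:R * harm R N / N%:R.
pose f (i : 'I_N) := \sum_(x <- s) `|i%:R - x|^-1.
have [i iG fi] : exists2 i, i \in G & f i <= b.
  apply: contrapT => h.
  have lt_f i : i \in G -> b < f i.
    by move=> iG; rewrite ltNge; apply/negP => fi; apply: h; exists i.
  have [g gG] : exists g, g \in G by move: G0; rewrite card_gt0 => /finset.set0Pn.
  have : \sum_(i in G) b < \sum_(i in G) f i.
    by apply: ltr_sum => //; apply/hasP; exists g => //; rewrite mem_index_enum.
  apply/negP; rewrite -leNgt sumr_const -[b *+ _]mulr_natl.
  apply: (@le_trans _ _ (4 * (size s)%:R * harm R N)); last first.
    rewrite /b -(ler_pM2r (_ : 0 < N%:R)) ?ltr0n //.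
    rewrite !mulrA divfK ?pnatr_eq0 //.
    have : N%:R <= 2 * #|G|%:R :> R by rewrite -natrM ler_nat.
    have h0 : 0 <= 4 * (size s)%:R * harm R N :> R by rewrite !mulr_ge0 // harm_ge0.
    by move/(ler_wpM2l h0); lra.
  rewrite /f exchange_big /= (_ : _ * harm R N = \sum_(x <- s) (4 * harm R N)).
    rewrite !big_seq; apply: ler_sum => x xs.
    apply: (@le_trans _ _ (\sum_(i in G) 2 * `|i%:R - (near x)%:R|^-1)).
      apply: ler_sum => i iG; have d0 := GP i x iG xs.
      have := svalP (nearest x) i; rewrite -/(near x) => le_d.
      have x0 : 0 < `|i%:R - x| by lra.
      by rewrite -[2]invrK -invfM lef_pV2 ?posrE ?mulr_gt0 ?invr_gt0 //; lra.
    rewrite -mulr_sumr (_ : 4 * harm R N = 2 * (2 * harm R N)); last by ring.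
    rewrite ler_pM2l //; apply: le_trans (sum_inv_dist (near x)).
    rewrite [leRHS](bigID (mem G)) /= lerDl; apply: sumr_ge0 => k _.
    by rewrite invr_ge0.
  by rewrite big_const_seq count_predT iter_addr_0 -[_ *+ _]mulr_natl; ring.
exists i => // x xs.
have := GP i x iG xs; have := svalP (nearest x) i; rewrite -/(near x).
move=> le_d d0; apply/eqP => ix; move: (lt_le_trans d0 le_d).
by rewrite ix subrr normr0 mulr0 ltxx.
Qed.
End Harmonic.

(** * Logarithmic derivatives *)

Section LogDerivative.
Variable R : realType.
Implicit Types (s : seq R[i]) (z u w : R[i]).

Definition rootprod s : {poly R[i]} := \prod_(a <- s) ('X - a%:P).
Definition logder s z : R[i] := \sum_(a <- s) (z - a)^-1.

Lemma normc_complexE z : (normc z)%:C = `|z|.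
Proof. by case: z. Qed.

Lemma normc_sqr z : normc z ^+ 2 = complex.Re z ^+ 2 + complex.Im z ^+ 2.
Proof. by case: z => a b /=; rewrite sqr_sqrtr // addr_ge0 ?sqr_ge0. Qed.

Lemma normc_ge0 z : 0 <= normc z.
Proof. by case: z => a b /=; exact: sqrtr_ge0. Qed.

Lemma normc_gt0 z : (0 < normc z) = (z != 0).
Proof.
rewrite lt_def normc_ge0 andbT; congr (~~ _).
by apply/eqP/eqP => [/eq0_normc//|->]; exact: normc0.
Qed.

Lemma normc_triangle z w : normc (z + w) <= normc z + normc w.
Proof. exact: le_normcD. Qed.

Lemma normc_dist z w : normc (z - w) = normc (w - z).
Proof. by rewrite -normcN opprB. Qed.

Lemma deriv_rootprod s z : z \notin s ->
  (rootprod s)^`().[z] = (rootprod s).[z] * logder s z.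
Proof.
rewrite /rootprod /logder; elim: s => [|a s IH]; first by rewrite !big_nil derivC horner0 mulr0.
rewrite inE negb_or => /andP[za zs]; rewrite !big_cons derivM derivXsubC mul1r.
rewrite hornerD !hornerM IH // hornerXsubC mulrDr mulrA.
by rewrite [X in _ = X + _]mulrAC divff ?subr_eq0 // mul1r.
Qed.

Lemma Re_sum (I : Type) (r : seq I) (F : I -> R[i]) :
  complex.Re (\sum_(i <- r) F i) = \sum_(i <- r) complex.Re (F i).
Proof.
elim: r => [|i r IH]; rewrite ?big_nil // !big_cons -IH.
by case: (F i) => ? ?; case: (\sum_(_ <- _) _).
Qed.

Lemma Re_logder_ge s z u e : (forall a, a \in s -> e <= complex.Re (u / (z - a))) ->
  e * (size s)%:R <= complex.Re (u * logder s z).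
Proof.
move=> h; rewrite /logder mulr_sumr Re_sum mulr_natr -iter_addr_0 -count_predT -big_const_seq.
by rewrite !big_seq; apply: ler_sum.
Qed.

(** If the terms of the logarithmic derivative all point into the half-plane of
    direction u, they cannot cancel. *)
Lemma normc_logder_ge s z u e : (forall a, a \in s -> e <= complex.Re (u / (z - a))) ->
  e * (size s)%:R <= normc u * normc (logder s z).
Proof.
move=> h; rewrite -normcM; apply: (le_trans (Re_logder_ge h)).
by apply: le_trans (ler_norm _) (normc_geRe _).
Qed.

Lemma normc_logder_le s z : normc (logder s z) <= \sum_(a <- s) (normc (z - a))^-1.
Proof.
rewrite /logder; elim: s => [|a s IH]; first by rewrite !big_nil normc0.
by rewrite !big_cons; apply: (le_trans (normc_triangle _ _)); rewrite normcV lerD.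
Qed.

Lemma Re_divc u z : complex.Re (u / z) = complex.Re (u * z^*) / normc z ^+ 2.
Proof.
rewrite normc_sqr; case: u z => a b [c d] /=. ring.
Qed.

End LogDerivative.

(** * Distance to a convex set *)

Section Distance.
Variables (R : realType) (K : set R[i]).
Hypothesis K0 : K !=set0.
Implicit Types (z w : R[i]).

Definition distc z : R := inf [set normc (z - w) | w in K].

Let dist_lbound z : has_lbound [set normc (z - w) | w in K].
Proof. by exists 0 => _ [w _ <-]; exact: normc_ge0. Qed.

Let dist_nonempty z : [set normc (z - w) | w in K] !=set0.
Proof. by have [w Kw] := K0; exists (normc (z - w)), w. Qed.

Lemma distc_le z w : K w -> distc z <= normc (z - w).
Proof. by move=> Kw; apply: ge_inf => //; exists w. Qed.

Lemma distc_ge0 z : 0 <= distc z.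
Proof. by apply: lb_le_inf => // _ [w _ <-]; exact: normc_ge0. Qed.

Lemma distc_lt z t : distc z < t -> exists2 w, K w & normc (z - w) < t.
Proof.
rewrite -subr_gt0 => h.
have [_ [w Kw <-] lt_w] := inf_adherent h (conj (dist_nonempty z) (dist_lbound z)).
by exists w => //; move: lt_w; rewrite -/(distc z); lra.
Qed.

Lemma distc_in z : K z -> distc z = 0.
Proof.
move=> Kz; apply/eqP; rewrite eq_le distc_ge0 andbT.
by apply: le_trans (distc_le z Kz) _; rewrite subrr normc0.
Qed.

Lemma distc_sub z w : distc z - distc w <= normc (z - w).
Proof.
rewrite lerBlDr -lerBlDl; apply: lb_le_inf => // _ [v Kv <-].
rewrite lerBlDl; apply: le_trans (distc_le z Kv) _.
by rewrite -[z - v](subrKA w); exact: le_normcD.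
Qed.

Lemma distc_lip z w : `|distc z - distc w| <= normc (z - w).
Proof.
rewrite ler_norml distc_sub andbT lerNl opprB normc_dist; exact: distc_sub.
Qed.

Lemma distc_continuous : continuous (fun v : R * R => distc (v.1 +i* v.2)).
Proof.
move=> v; apply/cvgrPdist_lt => e e0.
have e2 : 0 < e / 2 by rewrite divr_gt0.
near=> w.
apply: le_lt_trans (distc_lip _ _) _.
have -> : (v.1 +i* v.2) - (w.1 +i* w.2) = (v.1 - w.1)%:C + (0 +i* (v.2 - w.2)).
  by rewrite /=; simpc.
apply: le_lt_trans (normc_triangle _ _) _.
rewrite /= !expr0n /= addr0 add0r !sqrtr_sqr [e]splitr; apply: ltrD.
  near: w; move: (e / 2) e2; apply/cvgrPdist_lt; exact: cvg_fst.
near: w; move: (e / 2) e2; apply/cvgrPdist_lt; exact: cvg_snd.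
Unshelve. all: by end_near. Qed.

Hypothesis K_convex : complex_convex K.

Lemma convexP (l : R) z w : 0 <= l <= 1 -> K z -> K w -> K (w + l%:C * (z - w)).
Proof.
move=> /andP[l0 l1] Kz Kw.
have := @K_convex z w (Itv01 l0 l1) (mem_set Kz) (mem_set Kw).
move/set_mem; congr K.
case: z w {Kz Kw} => a b [c d].
rewrite /conv /= /unstable.onem; simpc; congr (_ +i* _); ring.
Qed.

(** Here u is z - w0 for a point w0 of K that almost realizes the distance t from z
    to K. By convexity w0 + l (w - w0) is in K, hence at distance at least t from z;
    expanding the square bounds the scalar product of z - w0 and w - w0 by t^2/2,
    so that of z - w0 and z - w is at least t^2/2. Working with an almost
    nearest point avoids the closure of K. *)
Lemma separation (D : R) z : 0 < distc z ->
  (forall w, K w -> normc (z - w) <= D) ->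
  exists2 u, normc u <= D &
    forall w, K w -> distc z ^+ 2 / (2 * D ^+ 2) <= complex.Re (u / (z - w)).
Proof.
set t := distc z => t0 hD.
have [w1 Kw1] := K0.
have tD : t <= D := le_trans (distc_le z Kw1) (hD _ Kw1).
have D0 : 0 < D := lt_le_trans t0 tD.
(* l makes the quadratic term l^2 |w - w0|^2 <= 4 l^2 D^2 equal to l t^2/2, and del
   below, the error on t^2, has the same size *)
pose l := t ^+ 2 / (8 * D ^+ 2).
have D2 : 0 < 8 * D ^+ 2 by rewrite mulr_gt0 ?exprn_gt0.
have l0 : 0 < l by rewrite divr_gt0 ?exprn_gt0.
have lE : l * D ^+ 2 * 8 = t ^+ 2 by rewrite /l; field; exact: lt0r_neq0.
have l1 : l <= 1.
  rewrite /l ler_pdivrMr // mul1r; apply: (@le_trans _ _ (D ^+ 2)).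
    by rewrite ler_sqr ?nnegrE ?(ltW t0) ?(ltW D0).
  by rewrite ler_peMl ?sqr_ge0 // ler1n.
pose del := l * t ^+ 2 / 2.
have del0 : 0 < del by apply: divr_gt0 => //; apply: mulr_gt0 => //; exact: exprn_gt0.
have td : t < Num.sqrt (t ^+ 2 + del).
  by rewrite -[ltLHS]ger0_norm ?ltW // -sqrtr_sqr ltr_sqrt ?ltrDl // addr_gt0 ?exprn_gt0.
have [w0 Kw0 hw0] := distc_lt td.
have hw02 : normc (z - w0) ^+ 2 < t ^+ 2 + del.
  rewrite -[ltRHS]sqr_sqrtr; last by rewrite addr_ge0 ?sqr_ge0 // ltW.
  by rewrite ltr_sqr ?nnegrE ?normc_ge0 // sqrtr_ge0.
exists (z - w0); first exact: hD.
move=> w Kw.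
have tzw : t <= normc (z - w) by exact: distc_le.
have n0 : 0 < normc (z - w) := lt_le_trans t0 tzw.
have n2 : normc (z - w) ^+ 2 <= D ^+ 2.
  by rewrite ler_sqr ?nnegrE ?normc_ge0 ?(ltW D0) // hD.
have h0 : t ^+ 2 <= normc (z - w0) ^+ 2 by rewrite ler_sqr ?nnegrE ?normc_ge0 ?(ltW t0) // distc_le.
have hl : t ^+ 2 <= normc (z - (w0 + l%:C * (w - w0))) ^+ 2.
  rewrite ler_sqr ?nnegrE ?normc_ge0 ?(ltW t0) // distc_le //.
  by apply: convexP; rewrite ?(ltW l0).
have hww : normc (w - w0) ^+ 2 <= 4 * D ^+ 2.
  rewrite [leRHS](_ : _ = (2 * D) ^+ 2); last by ring.
  rewrite ler_sqr ?nnegrE ?normc_ge0 ?mulr_ge0 ?(ltW D0) //.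
  rewrite -[w - w0](subrKA z); apply: le_trans (normc_triangle _ _) _.
  by have h1 := hD _ Kw; have h2 := hD _ Kw0; rewrite (normc_dist w); lra.
rewrite Re_divc.
suff h : t ^+ 2 / 2 <= complex.Re ((z - w0) * (z - w)^*).
  rewrite ler_pdivlMr ?exprn_gt0 //; apply: le_trans h.
  have -> (x : R) : t ^+ 2 / (2 * D ^+ 2) * x = t ^+ 2 / 2 * x / D ^+ 2.
    by rewrite invfM; ring.
  rewrite ler_pdivrMr ?exprn_gt0 //.
  by apply: ler_wpM2l => //; rewrite divr_ge0 ?sqr_ge0.
have ineq : l ^+ 2 * normc (w - w0) ^+ 2 <= l ^+ 2 * (4 * D ^+ 2).
  by rewrite ler_wpM2l ?sqr_ge0.
have lE2 : l ^+ 2 * (4 * D ^+ 2) = l * t ^+ 2 / 2 by rewrite -lE; field.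
rewrite lE2 in ineq; move: hw02; rewrite /del => hw02.
rewrite -(ler_pM2l l0).
move: ineq hl h0 hw02; rewrite !normc_sqr.
clearbody l t; clear - l0 t0.
case: z w w0 => a b [c d] [e f] /=.
move=> *; nra.
Qed.

End Distance.

(** * Multiplicities and coefficients *)

Lemma nb_roots_count (F : fieldType) (c : F) (rs : seq F) (S : set F) :
  c != 0 -> nb_roots (c *: \prod_(z <- rs) ('X - z%:P)) S = count (fun z => z \in S) rs.
Proof.
move=> c0; rewrite /nb_roots.
have mupE z : mup z (c *: \prod_(z <- rs) ('X - z%:P)) = count_mem z rs.
  by rewrite -mul_polyC mupMr ?rootC // mu_prod_XsubC.
rewrite (eq_fsbigr (fun z => count_mem z rs)); last by move=> z _; exact: mupE.
rewrite -(@fsbig_widen _ _ _ _ [set` [seq z <- undup rs | z \in S]]).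
- rewrite -fsbig_seq ?filter_uniq ?undup_uniq // big_filter -sum1_count.
  rewrite -[RHS]big_undup_iterop_count; apply: eq_bigr => z _.
  by elim: (count_mem z rs) => // -[|n] //= ->.
- by move=> z /=; rewrite mem_filter => /andP[/set_mem].
- move=> z [Sz /= /negP]; rewrite mem_filter mem_undup (mem_set Sz) /= => zrs.
  exact/count_memPn.
Qed.

Lemma coefM_top (F : nzRingType) (p q : {poly F}) (a b : nat) :
  (size p <= a.+1)%N -> (size q <= b.+1)%N -> (p * q)`_(a + b) = p`_a * q`_b.
Proof.
move=> pa qb; rewrite coefM (bigD1 (inord a)) //= inordK ?ltnS ?leq_addr // addKn.
rewrite big1 ?addr0 // => j ja.
have {}ja : nat_of_ord j != a.
  apply: contra ja => /eqP ja; apply/eqP/val_inj.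
  by rewrite /= inordK ?ltnS ?leq_addr.
case: (ltngtP j a) ja => // ja _.
  by rewrite [q`_ _](nth_default 0) ?mulr0 //; apply: leq_trans qb _; lia.
by rewrite nth_default ?mul0r //; apply: leq_trans pa _.
Qed.

(** * The pencil from q' r to (q r)' *)

Section Transport.
Variable R : realType.
Implicit Types (q r : seq R[i]) (z : R[i]).

(** With a roots in q and b roots in r, the coefficient of degree a - 1 + b is a in
    q' r and a + b in (q r)', hence b in q r', and a + s b > 0 in the pencil at s. *)
Lemma size_transport q r (s : R) : 0 <= s <= 1 -> (0 < size q)%N ->
  size (pencil ((rootprod q)^`() * rootprod r) (rootprod q * (rootprod r)^`()) s)
    = ((size q).-1 + size r).+1.
Proof.
move=> /andP[s0 _] q0; set m := (size q).-1; set k := size r.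
have sq : size (rootprod q) = m.+2 by rewrite /rootprod size_prod_XsubC prednK.
have sr : size (rootprod r) = k.+1 by rewrite /rootprod size_prod_XsubC.
have lq : (rootprod q)`_m.+1 = 1.
  by have /monicP := monic_prod_XsubC q xpredT id; rewrite lead_coefE -/(rootprod q) sq.
have lr : (rootprod r)`_k = 1.
  by have /monicP := monic_prod_XsubC r xpredT id; rewrite lead_coefE -/(rootprod r) sr.
have sq' : (size (rootprod q)^`() <= m.+1)%N.
  by rewrite -ltnS -sq lt_size_deriv // -size_poly_eq0 sq.
have sr' : (size (rootprod r)^`() <= k)%N.
  by rewrite -ltnS -sr lt_size_deriv // -size_poly_eq0 sr.
have cA : ((rootprod q)^`() * rootprod r)`_(m + k) = m.+1%:R.
  by rewrite coefM_top ?sr // coef_deriv lq lr mulr1.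
have cB : (rootprod q * (rootprod r)^`())`_(m + k) = k%:R.
  have := coef_deriv (rootprod q * rootprod r) (m + k).
  rewrite derivM coefD cA -addSn (coefM_top (a := m.+1) (b := k)) ?sq ?sr //.
  rewrite lq lr mulr1 => /(canRL (addKr _)) ->.
  by rewrite natrD addKr.
apply/eqP; rewrite eqn_leq; apply/andP; split.
  rewrite /pencil; apply: leq_trans (size_polyD _ _) _; rewrite geq_max.
  apply/andP; split; last apply: leq_trans (size_scale_leq _ _) _;
    apply: leq_trans (size_polyMleq _ _) _; rewrite ?sr ?sq; lia.
rewrite ltnNge; apply/negP => /leq_sizeP /(_ _ (leqnn _)) /eqP.
rewrite coefD coefZ cA cB -(rmorph_nat (real_complex R)) -[k%:R](rmorph_nat (real_complex R)).
rewrite -rmorphM -rmorphD /= -(rmorph0 (real_complex R)) => /eqP [] /eqP.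
by apply/negP/lt0r_neq0; rewrite ltr_pwDl ?ltr0n // mulr_ge0.
Qed.

Lemma horner_transport q r (s : R) z : z \notin q -> z \notin r ->
  (pencil ((rootprod q)^`() * rootprod r) (rootprod q * (rootprod r)^`()) s).[z] =
  (rootprod q).[z] * (rootprod r).[z] * (logder q z + s%:C * logder r z).
Proof.
move=> zq zr; rewrite /pencil hornerD hornerZ !hornerM !deriv_rootprod //; ring.
Qed.

Lemma root_rootprod q z : root (rootprod q) z = (z \in q).
Proof. exact: root_prod_XsubC. Qed.

(** Gauss-Lucas for the disc of radius M: at a point z outside of it, the terms of
    q'/q and of r'/r have positive real part once multiplied by z. *)
Lemma transport_root_bounded q r (s M : R) z : 0 <= s <= 1 -> (0 < size q)%N ->
  (forall a, a \in q ++ r -> normc a <= M) ->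
  root (pencil ((rootprod q)^`() * rootprod r) (rootprod q * (rootprod r)^`()) s) z ->
  normc z <= M.
Proof.
move=> /andP[s0 _] q0 hM; apply: contraTT; rewrite -ltNge => zM.
have zqr a : a \in q ++ r -> 0 < complex.Re (z / (z - a)).
  move=> /hM aM; have az := le_lt_trans aM zM.
  have za : 0 < normc (z - a).
    by rewrite normc_gt0 subr_eq0; apply: contraTneq az => ->; rewrite ltxx.
  rewrite Re_divc divr_gt0 ?exprn_gt0 //.
  have h : complex.Re (z * a^*) <= normc z * normc a.
    apply: le_trans (ler_norm _) _; apply: le_trans (normc_geRe _) _.
    by rewrite normcM; case: (a) => x y /=; rewrite sqrrN.
  have -> : complex.Re (z * (z - a)^*) = normc z ^+ 2 - complex.Re (z * a^*).
    by rewrite normc_sqr; case: (z) (a) => x y [u v] /=; ring.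
  rewrite subr_gt0; apply: le_lt_trans h _; rewrite expr2 ltr_pM2l //.
  by apply: le_lt_trans zM; apply: le_trans aM; exact: normc_ge0.
have notin a : a \in q ++ r -> a != z.
  move=> /zqr; apply: contraTneq => ->.
  by rewrite subrr invr0 mulr0 ltxx.
have zq : z \notin q by apply/negP => zq; have := notin z; rewrite mem_cat zq eqxx => /(_ isT).
have zr : z \notin r by apply/negP => zr; have := notin z; rewrite mem_cat zr orbT eqxx => /(_ isT).
rewrite /root horner_transport // mulf_neq0 //.
  by rewrite mulf_neq0 // -[_ == 0]/(root _ _) root_rootprod.
have re_q : 0 < complex.Re (z * logder q z).
  rewrite /logder mulr_sumr Re_sum; case: q q0 zqr {hM notin zq} => // a q _ zqr.
  rewrite big_cons ltr_pwDl ?zqr ?mem_head //.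
  rewrite big_seq sumr_ge0 // => b bq; apply/ltW/zqr.
  by rewrite mem_cat inE bq orbT.
have re_r : 0 <= complex.Re (z * logder r z).
  rewrite /logder mulr_sumr Re_sum big_seq sumr_ge0 // => b br; apply/ltW/zqr.
  by rewrite mem_cat br orbT.
apply/negP => /eqP /(congr1 (fun w => complex.Re (z * w))).
rewrite mulr0 mulrDr mulrCA.
have -> (u v : R[i]) : complex.Re (u + s%:C * v) = complex.Re u + s * complex.Re v.
  by case: u v => x y [x' y'] /=; ring.
by apply/eqP/lt0r_neq0; rewrite ltr_pwDl // mulr_ge0.
Qed.

End Transport.

(** * Roots below a level of the distance *)

Section Level.
Variables (R : realType) (K : set R[i]) (M : R).
Hypothesis K0 : K !=set0.
Hypothesis K_convex : complex_convex K.
Hypothesis K_le : forall w, K w -> normc w <= M.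
Implicit Types (q r : seq R[i]) (z : R[i]).

(** This quantitative Gauss-Lucas theorem bounds q'/q from below outside the
    closure of K, by the separation of z from K. *)
Lemma logder_lower q z (D : R) : (forall a, a \in q -> K a) -> 0 < distc K z ->
  normc z + M <= D ->
  distc K z ^+ 2 / (2 * D ^+ 3) * (size q)%:R <= normc (logder q z).
Proof.
move=> qK dz zD.
have hD w : K w -> normc (z - w) <= D.
  move=> Kw; apply: le_trans zD; apply: le_trans (normc_triangle _ _) _.
  by rewrite normcN lerD2l K_le.
have [u uD hu] := separation K0 K_convex dz hD.
have D0 : 0 < D.
  have [w Kw] := K0; apply: lt_le_trans dz _; apply: le_trans (hD _ Kw).
  exact: distc_le.
have h : distc K z ^+ 2 / (2 * D ^+ 2) * (size q)%:R <= D * normc (logder q z).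
  apply: le_trans (normc_logder_ge (u := u) _) _; first by move=> a /qK /hu; exact.
  by apply: ler_wpM2r => //; exact: normc_ge0.
rewrite -(ler_pM2l D0); apply: le_trans h; rewrite le_eqVlt; apply/orP; left.
by apply/eqP; field; exact: lt0r_neq0.
Qed.

(** The hypothesis on the sum says that |r'/r| < |q'/q| on the level t, so that
    no member of the pencil from q' r to (q r)' has a root on that level. *)
Lemma level_count q r (cs : seq R[i]) (t D : R) :
  (0 < size q)%N -> (forall a, a \in q -> K a) -> 0 < t ->
  (forall z, distc K z = t -> normc z + M <= D) ->
  (forall w, w \in r -> distc K w != t) ->
  \sum_(w <- r) `|t - distc K w|^-1 < t ^+ 2 / (2 * D ^+ 3) * (size q)%:R ->
  (rootprod q * rootprod r)^`() = lead_coef (rootprod q * rootprod r)^`() *: rootprod cs ->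
  ((size q).-1 <= count (fun z => distc K z <= t)%R cs)%N.
Proof.
move=> q0 qK t0 hD rt small csE.
pose A := (rootprod q)^`() * rootprod r; pose B := rootprod q * (rootprod r)^`().
have p0 : pencil A B 0 = A by rewrite /pencil scale0r addr0.
have p1 : pencil A B 1 = (rootprod q * rootprod r)^`() by rewrite /pencil scale1r derivM.
have [sq sqE] := closed_field_poly_normal (rootprod q)^`().
pose l := lead_coef (rootprod q)^`(); rewrite -/l in sqE.
have sz_q' : size (rootprod q)^`() = (size q).-1.+1.
  have := size_transport [::] (_ : 0 <= (0 : R) <= 1) q0.
  rewrite /pencil scale0r addr0 {2}/rootprod big_nil mulr1 addn0; apply.
  by rewrite lexx ler01.
have l0 : l != 0 by rewrite lead_coef_eq0 -size_poly_eq0 sz_q'.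
have AE : A = l *: rootprod (sq ++ r).
  by rewrite /A sqE /rootprod big_cat /= scalerAl.
have sz_sq : size sq = (size q).-1.
  by have := sz_q'; rewrite sqE size_scale // size_prod_XsubC => -[].
have sq_in z : z \in sq -> distc K z <= t.
  move=> zsq; rewrite leNgt; apply/negP => tz.
  have dz : 0 < distc K z := lt_trans t0 tz.
  have zq : z \notin q.
    by apply/negP => /qK /distc_in dz0; rewrite dz0 // ltxx in dz.
  have : root (rootprod q)^`() z by rewrite sqE rootZ // root_prod_XsubC.
  rewrite /root deriv_rootprod // mulf_eq0 -[X in X || _]/(root _ _) root_rootprod (negPf zq) /=.
  apply/negP; rewrite -normc_gt0; apply: lt_le_trans (logder_lower qK dz (lexx _)).
  have zM : 0 < normc z + M.
    have [w Kw] := K0; apply: lt_le_trans dz _; apply: le_trans (distc_le z Kw) _.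
    by apply: le_trans (normc_triangle _ _) _; rewrite normcN lerD2l K_le.
  by rewrite mulr_gt0 ?ltr0n // divr_gt0 ?mulr_gt0 ?exprn_gt0.
have szAB (s : R) : 0 <= s <= 1 -> size (pencil A B s) = ((size q).-1 + size r).+1.
  by move=> s01; exact: size_transport.
pose N : R := \sum_(a <- q ++ r) normc a.
have hN a : a \in q ++ r -> normc a <= N.
  move=> aqr; rewrite /N (perm_big _ (perm_to_rem aqr)) big_cons /= lerDl sumr_ge0 // => b _.
  exact: normc_ge0.
have bnd (s : R) z : 0 <= s <= 1 -> root (pencil A B s) z -> normc z <= N.
  by move=> s01; apply: transport_root_bounded.
pose phi z := distc K z - t.
have cphi : continuous (fun v : R * R => phi (v.1 +i* v.2)).
  move=> v; apply: cvgB; last exact: cvg_cst.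
  exact: distc_continuous.
have phi0 (s : R) z : 0 <= s <= 1 -> root (pencil A B s) z -> phi z != 0.
  move=> /andP[s0 s1]; apply: contraTneq => /eqP; rewrite subr_eq0 => /eqP zt.
  have zq : z \notin q.
    by apply/negP => /qK /(distc_in K0) dz0; move: t0; rewrite -zt dz0 ltxx.
  have zr : z \notin r by apply/negP => /rt; rewrite zt eqxx.
  rewrite /root horner_transport // mulf_neq0 //.
    by rewrite mulf_neq0 // -[_ == 0]/(root _ _) root_rootprod.
  apply/negP; rewrite addr_eq0 => /eqP e.
  have lo : t ^+ 2 / (2 * D ^+ 3) * (size q)%:R <= normc (logder q z).
    by rewrite -zt; apply: logder_lower => //; rewrite ?zt //; exact: hD.
  have up : normc (logder q z) <= normc (logder r z).
    rewrite e normcN normcM /= expr0n /= addr0 sqrtr_sqr ger0_norm //.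
    by rewrite ler_piMl ?normc_ge0.
  have : normc (logder r z) <= \sum_(w <- r) `|t - distc K w|^-1.
    apply: le_trans (normc_logder_le _ _) _; rewrite !big_seq; apply: ler_sum => w wr.
    have tw : 0 < `|t - distc K w| by rewrite normr_gt0 subr_eq0 eq_sym rt.
    have le_tw : `|t - distc K w| <= normc (z - w) by rewrite -zt; exact: distc_lip.
    by rewrite lef_pV2 ?posrE // (lt_le_trans tw).
  move=> up2; have := lt_le_trans small (le_trans lo (le_trans up up2)).
  by rewrite ltxx.
have h0 : pencil A B 0 = lead_coef (pencil A B 0) *: \prod_(z <- sq ++ r) ('X - z%:P).
  rewrite p0 {1}AE; congr (_ *: _); rewrite AE lead_coefZ.
  by rewrite (monicP (monic_prod_XsubC _ _ _)) mulr1.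
have h1 : pencil A B 1 = lead_coef (pencil A B 1) *: \prod_(z <- cs) ('X - z%:P).
  by rewrite p1.
have := pencil_count szAB bnd cphi phi0 h0 h1.
rewrite (eq_count (a2 := fun z => distc K z <= t)); last by move=> z; rewrite /phi subr_le0.
rewrite [X in (_ <= X)%N](eq_count (a2 := fun z => distc K z <= t)); last first.
  by move=> z; rewrite /phi subr_le0.
apply: leq_trans; rewrite count_cat -sz_sq.
have /eqP -> : count (fun z => (distc K z <= t)%R) sq == size sq.
  by rewrite -all_count; apply/allP => z /sq_in.
exact: leq_addr.
Qed.

End Level.

(** * Choice of the level and of the constant *)

(** The grid is eps/2 + i h for i < n, with h = eps/(2n). *)
Lemma exists_good_level (R : realType) (eps : R) (n : nat) (ts : seq R) :
  0 < eps -> (0 < n)%N -> (2 * size ts <= n)%N ->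
  exists2 t : R, eps / 2 <= t < eps &
    (forall x, x \in ts -> x != t) /\
    \sum_(x <- ts) `|t - x|^-1 <= 16 * (size ts)%:R * harm R n / eps.
Proof.
move=> e0 n0 tsn.
have n0R : 0 < n%:R :> R by rewrite ltr0n.
pose h : R := eps / (2 * n%:R).
have h0 : 0 < h by rewrite divr_gt0 ?mulr_gt0.
pose g x := (x - eps / 2) / h.
have gE x (i : 'I_n) : eps / 2 + i%:R * h - x = h * (i%:R - g x).
  by rewrite /g; field; exact: lt0r_neq0.
have [] := @sparse_grid_point R n (map g ts) n0; first by rewrite size_map.
move=> i iP; rewrite big_map size_map => sumP.
exists (eps / 2 + i%:R * h).
  have i0 : 0 <= i%:R :> R by [].
  have iN : i%:R < n%:R :> R by rewrite ltr_nat.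
  have hn : n%:R * h = eps / 2 by rewrite /h; field; exact: lt0r_neq0.
  rewrite lerDl mulr_ge0 ?(ltW h0) //=.
  have : i%:R * h < n%:R * h by rewrite ltr_pM2r.
  by rewrite hn; lra.
split.
  move=> x xts; rewrite eq_sym -subr_eq0 gE.
  apply: mulf_neq0; [exact: lt0r_neq0|rewrite subr_eq0].
  by apply: iP; exact: map_f.
have -> : \sum_(x <- ts) `|eps / 2 + i%:R * h - x|^-1 =
    h^-1 * \sum_(x <- ts) `|i%:R - g x|^-1.
  rewrite mulr_sumr; apply: eq_bigr => x _.
  by rewrite gE normrM invfM gtr0_norm.
have := sumP; rewrite -(ler_pM2l (_ : 0 < h^-1)) ?invr_gt0 //.
move/le_trans; apply; rewrite le_eqVlt; apply/orP; left; apply/eqP.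
by rewrite /h; field; rewrite !lt0r_neq0.
Qed.

Lemma complex_bounded (R : realType) (K : set R[i]) : K !=set0 ->
  bounded_set (K : set R[i]^o) -> exists M : R, forall w, K w -> normc w <= M.
Proof.
move=> [w0 Kw0] [M [Mr hM]].
exists (complex.Re (M + 1)) => w Kw.
have Mr1 : M + 1 \is Num.real by rewrite realD.
have lt_M : M < M + 1 by rewrite ltrDl.
have : `|w| <= M + 1 := hM _ lt_M w Kw.
by rewrite -(RRe_real Mr1) -normc_complexE lecR.
Qed.

Theorem mainTheorem1 (R : realType) (K : set R[i])
    (K_domain : complex_domain K)
    (K_bounded : bounded_set (K : set R[i]^o))
    (K_convex : complex_convex K)
    (eps : R) (eps_gt0 : 0 < eps) :
  exists2 c : R, 0 < c &
    forall (n : nat) (p : {poly R[i]}), (2 <= n)%N -> size p = n.+1 ->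
      (nb_roots p (~` K))%:R <= c * (n%:R / ln (n%:R : R)) ->
      (nb_roots p K)%:Z - 1 <= (nb_roots p^`() (eps_neighborhood K eps))%:Z.
Proof.
have [K0 _ _] := K_domain.
have [M K_le] := complex_bounded K0 K_bounded.
have M0 : 0 <= M.
  by have [w Kw] := K0; apply: le_trans (normc_ge0 w) (K_le w Kw).
pose D : R := 2 * M + 2 * eps.
have D0 : 0 < D by rewrite /D ltr_wpDl ?mulr_ge0 ?mulr_gt0.
have ln2_gt0 : 0 < ln 2 :> R by rewrite ln_gt0 // ltr1n.
(* the n-th harmonic number is at most C ln n *)
pose C : R := 1 + (ln 2)^-1.
have C0 : 0 < C by rewrite ltr_wpDr ?invr_ge0 ?ltW.
(* c1 gives 2 k <= n; c2 makes the sum over the roots outside K at most half of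
   the lower bound for the logarithmic derivative of q *)
pose c1 : R := ln 2 / 2; pose c2 : R := eps ^+ 3 / (512 * C * D ^+ 3).
have c1_gt0 : 0 < c1 by rewrite divr_gt0.
have c2_gt0 : 0 < c2 by rewrite divr_gt0 ?mulr_gt0 ?exprn_gt0.
exists (Num.min c1 c2); first by rewrite lt_min c1_gt0.
move=> n p n2 szp.
have n_gt0 : (0 < n)%N by exact: leq_trans n2.
have nR : 0 < n%:R :> R by rewrite ltr0n.
have le_ln : ln 2 <= ln n%:R :> R by rewrite ler_ln ?posrE ?ltr0n // ler_nat.
have ln_n_gt0 : 0 < ln n%:R :> R := lt_le_trans ln2_gt0 le_ln.
have [rs pE] := closed_field_poly_normal p.
have lp0 : lead_coef p != 0 by rewrite lead_coef_eq0 -size_poly_eq0 szp.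
have sz_rs : size rs = n.
  by have := szp; rewrite pE size_scale // size_prod_XsubC => -[].
pose q := [seq z <- rs | z \in K]; pose r := [seq z <- rs | z \notin K].
have prs : perm_eq (q ++ r) rs by apply/permPl; exact: perm_filterC.
have nbK : nb_roots p K = size q by rewrite pE nb_roots_count // size_filter.
have nbKC : nb_roots p (~` K) = size r.
  by rewrite pE nb_roots_count // size_filter; apply: eq_count => z; rewrite in_setC.
rewrite nbK nbKC; set m := size q; set k := size r => kle.
have mk : (m + k = n)%N by rewrite -sz_rs -(perm_size prs) size_cat.
have k_lnn : k%:R * ln n%:R <= Num.min c1 c2 * n%:R.
  by move: kle; rewrite mulrA ler_pdivlMr.
have k1 : k%:R * ln n%:R <= c1 * n%:R.
  by apply: le_trans k_lnn _; rewrite ler_wpM2r ?(ltW nR) // ge_min lexx.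
have k2 : k%:R * ln n%:R <= c2 * n%:R.
  by apply: le_trans k_lnn _; rewrite ler_wpM2r ?(ltW nR) // ge_min lexx orbT.
have k2n : (2 * k <= n)%N.
  rewrite -(ler_nat R) natrM -(ler_pM2l ln2_gt0).
  have : k%:R * ln 2 <= c1 * n%:R by apply: le_trans k1; rewrite ler_wpM2l.
  by rewrite /c1; lra.
have [q_gt0 n_le_2m] : (0 < m)%N /\ (n <= 2 * m)%N.
  by move: (m) (k) mk k2n n_gt0 => a b; clear; lia.
have k2n' : (2 * size (map (distc K) r) <= n)%N by rewrite size_map.
have [t /andP[t_ge t_lt] [t_out t_sum]] := exists_good_level eps_gt0 n_gt0 k2n'.
rewrite size_map big_map -/k in t_sum.
have t_gt0 : 0 < t by apply: lt_le_trans t_ge; rewrite divr_gt0.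
pose f := rootprod q * rootprod r.
have fE : f = \prod_(z <- rs) ('X - z%:P).
  by rewrite /f /rootprod -big_cat /=; apply: perm_big.
have [cs csE] := closed_field_poly_normal f^`().
have f'0 : lead_coef f^`() != 0.
  have := size_transport r (_ : 0 <= (1 : R) <= 1) q_gt0.
  rewrite /pencil scale1r -derivM -/f lexx ler01 => /(_ isT) sz_f'.
  by rewrite lead_coef_eq0 -size_poly_eq0 sz_f'.
have p'E : p^`() = (lead_coef p * lead_coef f^`()) *: \prod_(z <- cs) ('X - z%:P).
  by rewrite {1}pE derivZ -fE {1}csE scalerA.
rewrite p'E nb_roots_count ?mulf_neq0 //.
have cnt : (m.-1 <= count (fun z => (distc K z <= t)%R) cs)%N.
  apply: (@level_count R K M K0 K_convex K_le q r cs t D) => //.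
  - by move=> a; rewrite mem_filter => /andP[/set_mem].
  - move=> z zt; have : distc K z < eps by rewrite zt.
    move=> /(distc_lt K0)[w Kw zw].
    rewrite -[z](subrK w) /D; have := normc_triangle (z - w) w; have := K_le _ Kw; lra.
  - by move=> w wr; apply: t_out; exact: map_f.
  apply: le_lt_trans t_sum _.
  have harm_n : harm R n <= C * ln n%:R.
    apply: le_trans (harm_le_ln R n_gt0) _; rewrite /C mulrDl mul1r addrC lerD2l.
    by rewrite mulrC ler_pdivlMr // mul1r.
  have k_harm : k%:R * harm R n <= C * (c2 * n%:R).
    apply: (@le_trans _ _ (k%:R * (C * ln n%:R))); first by rewrite ler_wpM2l.
    by rewrite mulrCA ler_pM2l.
  have m_ge : n%:R / 2 <= m%:R :> R.
    have : n%:R <= 2 * m%:R :> R by rewrite -natrM ler_nat.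
    lra.
  pose X : R := eps ^+ 2 / D ^+ 3 * n%:R.
  have X0 : 0 < X by rewrite mulr_gt0 ?divr_gt0 ?exprn_gt0.
  have lhs : 16 * k%:R * harm R n / eps <= X / 32.
    have -> : X / 32 = 16 / eps * (C * (c2 * n%:R)).
      by rewrite /X /c2; field; rewrite !lt0r_neq0.
    have -> : 16 * k%:R * harm R n / eps = 16 / eps * (k%:R * harm R n) by ring.
    by rewrite ler_wpM2l // divr_ge0 // ltW.
  have rhs : X / 16 <= t ^+ 2 / (2 * D ^+ 3) * m%:R.
    have -> : X / 16 = (eps / 2) ^+ 2 / (2 * D ^+ 3) * (n%:R / 2).
      by rewrite /X; field; exact: lt0r_neq0.
    have e2 : 0 <= eps / 2 by rewrite divr_ge0 // ltW.
    have D3 : 0 < 2 * D ^+ 3 by rewrite mulr_gt0 ?exprn_gt0.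
    apply: ler_pM => //; [by rewrite divr_ge0 ?sqr_ge0 // ltW|].
    by rewrite ler_pM2r ?invr_gt0 // ler_sqr ?nnegrE // (ltW t_gt0).
  apply: le_lt_trans lhs _; apply: lt_le_trans rhs; lra.
have sub : (count (fun z => (distc K z <= t)%R) cs <=
    count (fun z => z \in eps_neighborhood K eps) cs)%N.
  apply: sub_count => z /= zt; apply/mem_set.
  have /(distc_lt K0)[w Kw zw] := le_lt_trans zt t_lt.
  by exists w => //; rewrite -normc_complexE ltcR.
have := leq_trans cnt sub; set N := count _ _; move: (N) (m) => a b; clear; lia.
Qed.
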